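(* Let $X$ be a regular Lindelöf space. Then $X$ is productively Lindelöf if and only if $X$ has the pL property.
   Context: A topological space is Lindelöf if every open covering of it has a countable subcovering. A Lindelöf space $X$ is productively Lindelöf if $X\times Y$ is Lindelöf for every Lindelöf space $Y$. For a topological space $(X,\tau)$ let $\mathrm{O}$ denote the collection of all open coverings of $X$ (each element of $\mathrm{O}$ is a set $\mathcal U\subset\tau$ with $\bigcup\mathcal U=X$). A set $\mathcal Y\subset \mathrm{O}$ is a Lindelöf collection if for every function $f:\mathcal Y\to[\bigcup\mathcal Y]^{<\omega}$ (finite subsets of $\bigcup\mathcal Y$) such that $f(\mathcal U)\subset\mathcal U$ for all $\mathcal U\in\mathcal Y$, there is a sequence $(\mathcal U_n)_{n\in\omega}$ of elements of $\mathcal Y$ such that for every $\mathcal U\in\mathcal Y$ there is $n\in\omega$ with $f(\mathcal U_n)\subset\mathcal U$. $X$ has the pL property if for every Lindelöf collection $\mathcal Y\subset \mathrm{O}$ there is a sequence $(A_n)_{n\in\omega}$ of open subsets of $X$ such that for each $(x,\mathcal U)\in X\times\mathcal Y$ there is $n\in\omega$ with $x\in A_n\in\mathcal U$. *)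

(* Defs.v *)
From mathcomp Require Import all_boot all_order all_algebra.
From mathcomp Require Import all_classical.
From mathcomp Require Import topology.
Set Implicit Arguments.
Unset Strict Implicit.
Unset Printing Implicit Defensive.
Local Open Scope classical_set_scope.

Definition open_coverings (X : topologicalType) : set (set (set X)) :=
  [set U | (forall A, U A -> open A) /\ \bigcup_(A in U) A = [set: X]].
Arguments open_coverings X : clear implicits.

Definition lindelof_space (X : topologicalType) : Prop :=
  forall U, open_coverings X U ->
  exists V, [/\ V `<=` U, countable V & open_coverings X V].

Definition productively_lindelof (X : topologicalType) : Prop :=
  lindelof_space X /\
  forall Y : topologicalType, lindelof_space Y -> lindelof_space (X * Y)%type.

(* A selector f : Y -> [\bigcup Y]^{<\omega} is represented by a total function
   of which only the values on Y are constrained and used; the codomain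
   condition follows from f U `<=` U. *)
Definition lindelof_collection (X : topologicalType) (Y : set (set (set X))) :
    Prop :=
  Y `<=` open_coverings X /\
  forall f : set (set X) -> set (set X),
    (forall U, Y U -> finite_set (f U) /\ f U `<=` U) ->
    exists u : nat -> set (set X),
      (forall n, Y (u n)) /\ forall U, Y U -> exists n, f (u n) `<=` U.

Definition pL_property (X : topologicalType) : Prop :=
  forall Y : set (set (set X)), lindelof_collection Y ->
  exists A : nat -> set X,
    (forall n, open (A n)) /\
    forall (x : X) (U : set (set X)), Y U -> exists n, A n x /\ U (A n).

(* Main.v *)
Require Import Defs.
From HB Require Import structures.
From mathcomp Require Import all_boot all_order all_algebra.
From mathcomp Require Import all_classical.
From mathcomp Require Import topology.

(** From productivity to pL.  Give a collection Y of coverings the topology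
    generated by the sets [set U | F `<=` U] with F finite.  A selector f
    picks a basic neighbourhood of each point, so a Lindelof collection is a
    Lindelof space (covering_space_lindelof).  If X * Y is Lindelof, a countable
    subcover of the boxes A `*` [set U | U A], A open, is the sequence of open
    sets that pL asks for.

    From pL to productivity.  Let W be an open covering of X * Y.  Applying pL
    to the coverings U_y = [set A | open A /\ B A y] gives countable subcovers
    for coverings by boxes A `*` B A, that is, for box coverings in which the
    first side determines the second (pL_indexed_boxes).  In a general covering
    one A is paired with many sets, so the first side has to be made to
    remember its partner.  Since Y is Lindelof, each strip [set x] `*` setT is
    covered by countably many boxes, so boxes labelled by points of X and
    natural numbers suffice.  To cover C `*` setT with C closed, only the trace
    on C of a first side matters; outside C it can be changed to encode
    the label: if g sends labels injectively to closed sets disjoint from C,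
    then (A `|` ~` C) `\` g x has the trace of A and remembers x
    (coded_countably_covered).

    Such a g exists when C has at most as many points, up to topological
    indistinguishability, as some closed D disjoint from C
    (cells_le_covered).  Cardinals being comparable, this applies to C or to D.
    By regularity, any two points p and q separated by an open set containing p
    have disjoint closed neighbourhoods, so one of them has a neighbourhood N
    with N `*` setT countably covered (locally_covered_or).  If every point has
    such a neighbourhood, Lindelofness of X concludes.  Otherwise fix a
    point p without one: the strip over p lies in countably many boxes
    A_m `*` B_m, and each complement of A_m consists of points that do have
    such a neighbourhood. *)

Local Open Scope classical_set_scope.
Local Open Scope card_scope.

(** * Comparability of cardinals *)

(** A maximal partial injection from A to B, given by its graph, exhausts A or
    B, since otherwise a pair of missing points could be added to it. *)
Lemma card_le_or_ge (T U : pointedType) (A : set T) (B : set U) :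
  A #<= B \/ B #<= A.
Proof.
pose P := [set G : set (T * U) |
  [/\ forall a b, G (a, b) -> A a /\ B b,
      forall a b b', G (a, b) -> G (a, b') -> b = b' &
      forall a a' b, G (a, b) -> G (a', b) -> a = a']].
have [F FP Ftot|G [[GAB Gfun Ginj] Gmax]] := @Zorn_bigcup (T * U)%type P.
  have common p q : (\bigcup_(X in F) X) p -> (\bigcup_(X in F) X) q ->
      exists2 X, F X & X p /\ X q.
    move=> [X FX Xp] [Z FZ Zq].
    have [XZ|ZX] := Ftot X Z FX FZ.
      by exists Z => //; split => //; exact: XZ.
    by exists X => //; split => //; exact: ZX.
  split.
  - by move=> a b [X /FP[XAB _ _] /XAB].
  - move=> a b b' p q; have [X /FP[_ Xf _] [Xp Xq]] := common _ _ p q.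
    exact: Xf Xp Xq.
  - move=> a a' b p q; have [X /FP[_ _ Xi] [Xp Xq]] := common _ _ p q.
    exact: Xi Xp Xq.
have [Atot|/existsNP[a /not_implyP[Aa aG]]] :=
    pselect (forall a, A a -> exists b, G (a, b)).
  left; apply/pcard_surjP.
  have /choice[g gP] : forall b, exists a, (exists a', G (a', b)) -> G (a, b).
    move=> b; have [[a Gab]|no] := pselect (exists a', G (a', b)).
      by exists a.
    by exists point => /no.
  exists g => a Aa; have [b Gab] := Atot a Aa.
  exists b; first exact: (GAB _ _ Gab).2.
  by apply: (Ginj _ _ b _ Gab); apply: (gP b); exists a.
have [Btot|/existsNP[b /not_implyP[Bb bG]]] :=
    pselect (forall b, B b -> exists a, G (a, b)).
  right; apply/pcard_surjP.
  have /choice[g gP] : forall a, exists b, (exists b', G (a, b')) -> G (a, b).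
    move=> a'; have [[b Gab]|no] := pselect (exists b', G (a', b')).
      by exists b.
    by exists point => /no.
  exists g => b Bb; have [a' Gab] := Btot b Bb.
  exists a'; first exact: (GAB _ _ Gab).1.
  by apply: (Gfun a' _ _ _ Gab); apply: (gP a'); exists b.
exfalso; apply: (Gmax (G `|` [set (a, b)])).
  split; first by move=> p Gp; left.
  by move=> /(_ (a, b)) Gab; apply: aG; exists b; apply: Gab; right.
split.
- by move=> a' b' [/GAB//|[-> ->]].
- move=> a' b1 b2 [G1|[e1 ->]] [G2|[e2 ->]] //; first exact: Gfun G1 G2.
    by case: aG; exists b1; rewrite -e2.
  by case: aG; exists b2; rewrite -e1.
- move=> a1 a2 b' [G1|[-> e1]] [G2|[-> e2]] //; first exact: Ginj G1 G2.
    by case: bG; exists a1; rewrite -e2.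
  by case: bG; exists a2; rewrite -e1.
Qed.

(** * Countable subcovers as sequences *)

(** The form in which Lindelofness is used: each point chooses a neighbourhood
    with a property Q, and countably many such neighbourhoods suffice.  A space
    without points may have only the empty covering, which no sequence
    enumerates, hence the hypothesis [inhabited T]. *)
Lemma lindelof_seq (T : topologicalType) (Q : set T -> Prop) :
    lindelof_space T -> inhabited T ->
    (forall t, exists B, [/\ open B, B t & Q B]) ->
  exists u : nat -> set T,
    (forall n, open (u n) /\ Q (u n)) /\ forall t, exists n, u n t.
Proof.
move=> lindT [t0] nbQ.
have [|V [VQ cV [_ covV]]] := lindT [set B | open B /\ Q B].
  split; first by move=> B [].
  by apply/seteqP; split=> // t _; have [B [oB Bt QB]] := nbQ t; exists B.
have [V0|] := pfcard_geP cV.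
  by have: [set: T] t0 by []; rewrite -covV => -[B]; rewrite V0.
move=> [u]; exists u; split=> [n|t]; first by apply/VQ/(@funS _ _ _ _ u).
have: [set: T] t by []; rewrite -covV => -[B /(@surj _ _ _ _ u)[n _ <-] ut].
by exists n.
Qed.

Lemma seq_countable_subcover (T : topologicalType) (U : set (set T)) u :
    open_coverings T U -> (forall n : nat, U (u n)) ->
    (forall t, exists n, u n t) ->
  exists V, [/\ V `<=` U, countable V & open_coverings T V].
Proof.
move=> [Uo _] Uu ucov; exists (range u); split.
- by move=> _ [n _ <-].
- exact: card_image_le.
- split; first by move=> _ [n _ <-]; exact: Uo.
  apply/seteqP; split=> // t _; have [n unt] := ucov t.
  by exists (u n) => //; exists n.
Qed.

Lemma open_box (X Y : topologicalType) (w : set (X * Y)) x y :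
    open w -> w (x, y) ->
  exists A B, [/\ open A, open B, A x, B y & A `*` B `<=` w].
Proof.
move=> ow wxy; have /open_nbhs_nbhs[[A B] /= [nA nB] ABw] : open_nbhs (x, y) w.
  by [].
move: nA nB; rewrite !nbhsE => -[A' [oA' A'x] A'A] [B' [oB' B'y] B'B].
exists A', B'; split=> // -[a b] [/= A'a B'b]; apply: ABw.
by split; [exact: A'A|exact: B'B].
Qed.

Lemma open_setX (X Y : topologicalType) (A : set X) (B : set Y) :
  open A -> open B -> open (A `*` B).
Proof.
move=> oA oB; rewrite openE => -[x y] [/= Ax By].
by exists (A, B); [split; exact: open_nbhs_nbhs|].
Qed.

Lemma open_finite_bigcap (T : topologicalType) (I : choiceType) (D : set I)
    (f : I -> set T) :
  finite_set D -> (forall i, D i -> open (f i)) -> open (\bigcap_(i in D) f i).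
Proof.
move=> /finite_fsetP[E ->] fo; rewrite openE => x fx.
apply: filter_bigI => i iE; apply: open_nbhs_nbhs; split; first exact: fo.
exact: fx.
Qed.

(** * Lindelof collections as spaces of coverings *)

Section CoveringSpace.
Variables (X : topologicalType) (Y : set (set (set X))).

(** A copy of the subtype, so that it can carry its own topology. *)
Definition covering_space : Type := {U | Y U}.

HB.instance Definition _ := gen_eqMixin covering_space.
HB.instance Definition _ := gen_choiceMixin covering_space.

(** The topology generated by the sets of coverings to which a given open set
    belongs. *)
Definition covering_open : set_system covering_space :=
  [set O | forall U, O U -> exists F,
    [/\ finite_set F, F `<=` sval U &
        forall V : covering_space, F `<=` sval V -> O V]].

Lemma covering_openT : covering_open setT.
Proof. by move=> U _; exists set0; split=> //; exact: sub0set. Qed.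

Lemma covering_openI : setI_closed covering_open.
Proof.
move=> O1 O2 op1 op2 U [/op1[F1 [f1 s1 h1]] /op2[F2 [f2 s2 h2]]].
exists (F1 `|` F2); split; first by rewrite finite_setU.
  by move=> A [/s1|/s2].
by move=> V FV; split; [apply: h1|apply: h2] => A FA; apply: FV; [left|right].
Qed.

Lemma covering_open_bigU (I : Type) (f : I -> set covering_space) :
  (forall i, covering_open (f i)) -> covering_open (\bigcup_i f i).
Proof.
move=> opf U [i _ /opf[F [fF sF hF]]].
by exists F; split=> // V /hF fV; exists i.
Qed.

HB.instance Definition _ := isOpenTopological.Build covering_space
  covering_openT covering_openI covering_open_bigU.

Lemma openE_covering (O : set covering_space) : open O = covering_open O.
Proof.
rewrite openE propeqE; split=> [oO U /oO [B [oB BU BO]]|oO U OU].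
  by have [F [fF sF hF]] := oB U BU; exists F; split=> // V /hF /BO.
by exists O; split.
Qed.

(** The finite sets F that witness openness at each U form a selector f, and a
    sequence dominating f picks one element of W for each of its terms. *)
Lemma covering_space_lindelof :
  lindelof_collection Y -> lindelof_space covering_space.
Proof.
move=> [_ lindY] W [Wo Wcov].
have /choice[f fP] : forall U : set (set X), exists F, forall YU : Y U,
    [/\ finite_set F, F `<=` U &
      exists2 w, W w & forall V : covering_space, F `<=` sval V -> w V].
  move=> U; have [YU|] := pselect (Y U); last by exists set0.
  have: [set: covering_space] (exist _ U YU) by [].
  rewrite -Wcov => -[w Ww wU].
  have := Wo w Ww; rewrite openE_covering => /(_ _ wU)[F [fF sF hF]].
  by exists F => _; split=> //; exists w.
have [|u [Yu ucov]] := lindY f; first by move=> U /fP[].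
have /choice[w wP] : forall n, exists w, W w /\
    forall V : covering_space, f (u n) `<=` sval V -> w V.
  by move=> n; have [_ _ [w]] := fP _ (Yu n); exists w.
apply: (@seq_countable_subcover _ _ w) => //.
  by move=> n; have [] := wP n.
move=> U; have [n fnU] := ucov (sval U) (svalP U).
by exists n; apply: (wP n).2.
Qed.

End CoveringSpace.

(** The boxes A `*` [set V | sval V A] cover X * Y because every U in Y covers
    X; a countable subcover says exactly that the sets A satisfy the conclusion
    of pL. *)
Lemma productively_lindelof_pL (X : topologicalType) :
  productively_lindelof X -> pL_property X.
Proof.
move=> [_ prodX] Y lY; have [Ycov lindY] := lY.
have [[x0]|X0] := pselect (inhabited X); last first.
  by exists (fun=> set0); split=> [n|x]; [exact: open0|case: X0].
have [|u [Yu _]] := lindY (fun=> set0).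
  by move=> U _; split; [exact: finite_set0|exact: sub0set].
(* The selector with empty values yields an element u 0 of Y, so that the
   product is inhabited. *)
have lS := covering_space_lindelof _ _ lY.
have [||v [vP vcov]] := @lindelof_seq _
    (fun S : set (X * covering_space X Y) => exists2 A, open A &
      forall x U, S (x, U) -> A x /\ sval U A) (prodX _ lS).
- by constructor; exact: (x0, exist _ (u 0%N) (Yu 0%N)).
- move=> [x U]; have [Uo Ucov] := Ycov _ (svalP U).
  have: [set: X] x by []; rewrite -Ucov => -[A UA Ax].
  exists (A `*` [set V | sval V A]); split => //.
  + have oA := Uo A UA; apply: open_setX; first exact: Uo.
    rewrite openE_covering => V VA; exists [set A].
    split; [exact: finite_set1|by move=> _ ->|].
    by move=> W; apply.
  + by exists A; [exact: Uo|move=> ? ? []].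
have /choice[A AP] : forall n, exists A, open A /\
    forall x U, v n (x, U) -> A x /\ sval U A.
  by move=> n; have [_ [A ? ?]] := vP n; exists A.
exists A; split=> [n|x U YU]; first by have [] := AP n.
have [n vn] := vcov (x, exist _ U YU).
by exists n; exact: (AP n).2 _ _ vn.
Qed.

(** * Coverings by boxes under the pL property *)

(** The coverings [set A | open A /\ B A y] form a Lindelof collection: a
    finite selection F from the covering of y stays selectable on the
    intersection of the sets B A, A in F, which is a neighbourhood of y, and Y
    is Lindelof.  The sequence given by pL is the required one. *)
Lemma pL_indexed_boxes (X Y : topologicalType) (B : set X -> set Y) :
    pL_property X -> lindelof_space Y -> inhabited Y ->
    (forall A, open (B A)) ->
    (forall x y, exists A, [/\ open A, A x & B A y]) ->
  exists A : nat -> set X, forall x y, exists n, A n x /\ B (A n) y.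
Proof.
move=> pLX lindY inhY oB Bcov.
pose U y := [set A | open A /\ B A y].
have [|A [_ AP]] := pLX (range U).
  split.
    move=> _ [y _ <-]; split; first by move=> A [].
    apply/seteqP; split=> // x _; have [A [oA Ax BA]] := Bcov x y.
    by exists A.
  move=> f fP.
  have [|v [vP vcov]] := @lindelof_seq Y
      (fun N => exists y, forall z, N z -> f (U y) `<=` U z) lindY inhY.
    move=> y; have [fin sub] := fP (U y) (imageP _ I).
    exists (\bigcap_(A in f (U y)) B A); split.
    - by apply: open_finite_bigcap => // A _; exact: oB.
    - by move=> A /sub[].
    - by exists y => z zB A fA; split; [have [] := sub A fA|exact: zB].
  have /choice[y yP] : forall n, exists y, forall z, v n z -> f (U y) `<=` U z.
    by move=> n; have [_ [y]] := vP n; exists y.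
  exists (U \o y); split=> [n|_ [z _ <-]]; first exact: imageP.
  by have [n /yP] := vcov z; exists n.
exists A => x y; have [n [Anx [_ BA]]] := AP x (U y) (imageP _ I).
by exists n.
Qed.

(** * Countably covered subsets of a product *)

(** Using a sequence of members of W, which forces W to be nonempty even when D
    is empty, keeps countable unions a matter of reindexing. *)
Definition countably_covered (X Y : topologicalType) (W : set (set (X * Y)))
    (D : set (X * Y)) :=
  exists2 u : nat -> set (X * Y), (forall n, W (u n)) & D `<=` \bigcup_n u n.
Arguments countably_covered {X Y} W D.

Lemma countably_coveredS (X Y : topologicalType) (W : set (set (X * Y))) D E :
  D `<=` E -> countably_covered W E -> countably_covered W D.
Proof. by move=> DE [u Wu Eu]; exists u => //; exact: subset_trans Eu. Qed.

Lemma countably_covered1 (X Y : topologicalType) (W : set (set (X * Y))) w :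
  W w -> countably_covered W w.
Proof. by move=> Ww; exists (fun=> w) => // p wp; exists 0%N. Qed.

Lemma countably_covered_bigcup (X Y : topologicalType)
    (W : set (set (X * Y))) (D : nat -> set (X * Y)) :
  (forall n, countably_covered W (D n)) -> countably_covered W (\bigcup_n D n).
Proof.
move=> Dcov.
have /choice[u uP] : forall n, exists u : nat -> set (X * Y),
    (forall m, W (u m)) /\ D n `<=` \bigcup_m u m.
  by move=> n; have [u] := Dcov n; exists u.
exists (fun k => let p := odflt (0, 0)%N (unpickle k) in u p.1 p.2).
  by move=> k; exact: (uP _).1.
move=> p [n _ /(uP n).2[m _ upm]].
by exists (pickle (n, m)) => //; rewrite pickleK.
Qed.

Section ProductCovering.
Variables (X Y : topologicalType) (W : set (set (X * Y))).
Hypotheses (lindY : lindelof_space Y) (inhX : inhabited X) (inhY : inhabited Y).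
Hypothesis covW : open_coverings (X * Y)%type W.

(** The first sides may depend on the box since x is in all of them: only the
    second sides have to cover, and Y is Lindelof. *)
Lemma strip_boxes (x : X) :
  exists (A : nat -> set X) (B : nat -> set Y) (w : nat -> set (X * Y)),
    (forall m, [/\ open (A m), A m x, open (B m), W (w m) &
       A m `*` B m `<=` w m]) /\
    forall y, exists m, B m y.
Proof.
have [|B [BP Bcov]] := @lindelof_seq Y
    (fun N => exists A w, [/\ open A, A x, W w & A `*` N `<=` w]) lindY inhY.
  move=> y; have : [set: X * Y] (x, y) by [].
  rewrite -covW.2 => -[w Ww wxy].
  have [A [B [oA oB Ax By AB]]] := open_box _ _ _ _ _ (covW.1 _ Ww) wxy.
  by exists B; split => //; exists A, w.
have /choice[A AP] : forall m, exists A, exists w,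
    [/\ open A, A x, W w & A `*` B m `<=` w].
  by move=> m; have [_] := BP m.
have [w wP] := choice AP.
exists A, B, w; split=> // m.
by have [oA Ax Ww AB] := wP m; split=> //; have [] := BP m.
Qed.

Lemma countably_covered0 : countably_covered W set0.
Proof.
have [x] := inhX; have [A [B [w [wP _]]]] := strip_boxes x.
by exists w => // m; have [] := wP m.
Qed.

(** R is a set of labels: each point of C shares all open neighbourhoods of some
    r in R, so the boxes over the strips at points of R cover C `*` setT.
    Replacing A r m by [code r m] does not change its trace on C, as g r avoids
    C, while its union with C is the complement of g r and thus determines r.
    Each of the countably many sets given by pL is then the code of boxes over
    a single strip, and over C these boxes lie in countably many members of
    W. *)
Lemma coded_countably_covered (C R : set X) (g : X -> set X) :
    pL_property X -> closed C ->
    (forall r, R r -> closed (g r) /\ g r `<=` ~` C) ->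
    (forall r s, R r -> R s -> g r = g s -> r = s) ->
    (forall x, C x -> exists2 r, R r & forall A, open A -> A r -> A x) ->
  countably_covered W (C `*` setT).
Proof.
move=> pLX cC gR ginj repC.
have [A /choice[B /choice[w AP]]] := choice strip_boxes.
pose code r m := (A r m `|` ~` C) `\` g r.
have codeg r m : R r -> code r m `|` C = ~` g r.
  move=> Rr; have [_ gC] := gR r Rr; apply/seteqP; split=> z.
    by move=> [[]//|Cz /gC].
  by move=> gz; have [Cz|Cz] := pselect (C z); [right|left; split => //; right].
(* The first set makes ~` C with all of Y an admissible box: it takes care of
   the points outside C, and is never a box around a point of C. *)
pose N A' := [set y | A' = ~` C] `|`
  \bigcup_(r in R) \bigcup_(m in [set m | A' = code r m]) B r m.
have [A'|x y|S SP] := @pL_indexed_boxes X Y N pLX lindY inhY.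
- apply: openU.
    have [->|neq] := pselect (A' = ~` C).
      by rewrite (_ : [set _ | _] = setT); [exact: openT|apply/seteqP].
    rewrite (_ : [set _ | _] = set0); first exact: open0.
    by apply/seteqP; split=> y // /neq.
  apply: bigcup_open => r _; apply: bigcup_open => m _.
  by have [/(_ m)[]] := AP r.
- have [Cx|nCx] := pselect (C x); last first.
    by exists (~` C); split; [exact: closed_openC|exact: nCx|left].
  have [r Rr rx] := repC x Cx; have [Ar Brcov] := AP r.
  have [m By] := Brcov y; have [oA Ar_r _ _ _] := Ar m.
  have [cg gC] := gR r Rr.
  exists (code r m); split.
  + apply: openI; last exact: closed_openC.
    by apply: openU => //; exact: closed_openC.
  + by split; [left; exact: rx|move=> /gC].
  + by right; exists r => //; exists m.
apply: (@countably_coveredS _ _ _ _ (\bigcup_n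
  [set p | [/\ C p.1, S n p.1 & N (S n) p.2]])).
  by move=> [x y] [/= Cx _]; have [n [Sx Ny]] := SP x y; exists n.
apply: countably_covered_bigcup => n.
have [[r [Rr [m0 Sn]]]|noR] :=
    pselect (exists r, R r /\ exists m, S n = code r m); last first.
  apply: countably_coveredS countably_covered0 => -[x y] [/= Cx Sx].
  case=> [SC|[r Rr [m /= Sm _]]]; first by move: Sx; rewrite SC.
  by apply: noR; exists r; split=> //; exists m.
exists (w r); first by move=> m; have [/(_ m)[]] := AP r.
move=> [x y] [/= Cx Sx].
case=> [SC|[s Rs [m /= Sm Bsm]]]; first by move: Sx; rewrite SC.
have sr : s = r.
  apply: ginj => //; apply: setC_inj.
  by rewrite -(codeg s m)// -(codeg r m0)// -Sm -Sn.
move: Sm Bsm; rewrite {s Rs}sr => Sm Bm; exists m => //.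
have [/(_ m)[_ _ _ _ ABw] _] := AP r; apply: ABw; split=> //=.
by move: Sx; rewrite Sm => -[[]].
Qed.

(** In a regular space the point closures are the classes of topologically
    indistinguishable points; they replace points because no separation
    axiom T0 is assumed. *)
Definition cells (C : set X) : set (set X) := [set closure [set x] | x in C].

Lemma closed_cell (C : set X) x : closed C -> C x -> closure [set x] `<=` C.
Proof.
by move=> cC Cx; rewrite [X in _ `<=` X](closure_id C).1//;
  apply: closureS => _ ->.
Qed.

(** The labels are representatives of the cells of C, and the injection into
    the cells of D provides the closed sets outside C that encode them. *)
Lemma cells_le_covered (C D : set X) :
    pL_property X -> closed C -> closed D -> C `&` D = set0 ->
    cells C #<= cells D ->
  countably_covered W (C `*` setT).
Proof.
move=> pLX cC cD CD /pcard_leP[f].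
have [x0] := inhX.
have /choice[r rP] : forall K, exists x,
    cells C K -> C x /\ closure [set x] = K.
  move=> K; have [[x Cx <-]|no] := pselect (cells C K); first by exists x.
  by exists x0 => /no.
apply: (@coded_countably_covered C (r @` cells C) (f \o closure \o set1)) => //.
- move=> _ [K CK <-]; rewrite /= (rP K CK).2.
  have [z Dz <-] := @funS _ _ _ _ f K CK; split; first exact: closed_closure.
  move=> t /(closed_cell _ _ cD Dz) Dt Ct.
  by have : (C `&` D) t by []; rewrite CD.
- move=> _ _ [K CK <-] [L CL <-] /=; rewrite (rP K CK).2 (rP L CL).2 => fKL.
  by congr r; apply: (@inj _ _ _ f); rewrite ?inE.
- move=> x Cx; exists (r (closure [set x])).
    by exists (closure [set x]) => //; exists x.
  have [_ rx] := rP (closure [set x]) (imageP _ Cx).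
  move=> A oA Ar; have : closure [set x] (r (closure [set x])).
    by rewrite -{1}rx; exact: subset_closure.
  by move=> /(_ A)[|z [->]//]; apply: open_nbhs_nbhs; split.
Qed.

Definition locally_covered (x : X) :=
  exists2 V, nbhs x V & countably_covered W (closure V `*` setT).

(** Regularity gives p and q disjoint closed neighbourhoods, and the one with
    the fewer cells is covered. *)
Lemma locally_covered_or (G : set X) p q :
    pL_property X -> regular_space X -> open G -> G p -> ~ G q ->
  locally_covered p \/ locally_covered q.
Proof.
move=> pLX regX oG Gp Gq.
have [V nV VG] := regX p G (open_nbhs_nbhs (conj oG Gp)).
have [|U nU UV] := regX q (~` closure V).
  apply: open_nbhs_nbhs; split; last by move=> /VG.
  by apply: closed_openC; exact: closed_closure.
have VU : closure V `&` closure U = set0.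
  by apply/seteqP; split=> // z [Vz /UV].
have [le|le] := card_le_or_ge _ _ (cells (closure V)) (cells (closure U)).
  left; exists V => //; apply: cells_le_covered le => //; exact: closed_closure.
right; exists U => //.
by apply: cells_le_covered le => //; rewrite 1?setIC//; exact: closed_closure.
Qed.

(** The closed set ~` G inherits Lindelofness from X: G itself is added to the
    covering by good neighbourhoods. *)
Lemma locally_covered_setC (G : set X) :
    lindelof_space X -> open G -> (forall x, ~ G x -> locally_covered x) ->
  countably_covered W (~` G `*` setT).
Proof.
move=> lindX oG locG.
have [x|u [uP ucov]] := @lindelof_seq X
    (fun B => countably_covered W ((B `\` G) `*` setT)) lindX inhX.
  have [Gx|nGx] := pselect (G x).
    exists G; split=> //; rewrite setDv set0X; exact: countably_covered0.
  have [V nV Vcov] := locG x nGx.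
  exists V°; split; [exact: open_interior|exact: nV|].
  apply: countably_coveredS Vcov => -[a b] [/= [Va _] _]; split=> //=.
  by apply: subset_closure; exact: interior_subset.
apply: (@countably_coveredS _ _ _ _ (\bigcup_n ((u n `\` G) `*` setT))).
  by move=> [a b] [/= Ga _]; have [n una] := ucov a; exists n.
by apply: countably_covered_bigcup => n; have [] := uP n.
Qed.

(** At most one class of indistinguishable points fails to be locally covered.
    If it contains p, the boxes A m `*` B m over the strip at p leave,
    at height y in B m, only the points outside A m, and these are locally
    covered. *)
Lemma countably_covered_product :
    pL_property X -> regular_space X -> lindelof_space X ->
  countably_covered W setT.
Proof.
move=> pLX regX lindX.
have [allc|/existsNP[p pbad]] := pselect (forall x, locally_covered x).
  have := @locally_covered_setC set0 lindX open0 (fun x _ => allc x).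
  by apply: countably_coveredS => -[a b] _; split=> //=.
have [A [B [w [ABw Bcov]]]] := strip_boxes p.
have pG m : countably_covered W (~` A m `*` setT).
  have [oA Ap _ _ _] := ABw m; apply: locally_covered_setC => // q nAq.
  by have [] := locally_covered_or _ _ _ pLX regX oA Ap nAq.
apply: (@countably_coveredS _ _ _ _
  (\bigcup_n (~` A n `*` setT `|` A n `*` B n))).
  move=> [x y] _; have [m By] := Bcov y; exists m => //.
  by have [Ax|Ax] := pselect (A m x); [right|left].
apply: countably_covered_bigcup => m.
apply: (@countably_coveredS _ _ _ _
  (\bigcup_n (if n is 0%N then w m else ~` A m `*` setT))).
  move=> z [Az|ABz]; first by exists 1%N.
  by exists 0%N => //; have [_ _ _ _] := ABw m; apply.
apply: countably_covered_bigcup => -[|n]; last exact: pG.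
by apply: countably_covered1; have [] := ABw m.
Qed.

End ProductCovering.

Lemma pL_productively_lindelof (X : topologicalType) :
    regular_space X -> lindelof_space X -> pL_property X ->
  productively_lindelof X.
Proof.
move=> regX lindX pLX; split=> // Y lindY W covW.
have [[[x y]]|XY0] := pselect (inhabited (X * Y)); last first.
  exists set0; split; [exact: sub0set|exact: countable0|split=> //].
  by apply/seteqP; split=> // z; case: XY0.
have [u Wu ucov] := countably_covered_product X Y W lindY (inhabits x)
  (inhabits y) covW pLX regX lindX.
apply: (@seq_countable_subcover _ _ u) => // z.
by have [n _] := ucov z I; exists n.
Qed.

Theorem theorem2p13 (X : topologicalType) (regX : regular_space X)
    (lindX : lindelof_space X) :
  productively_lindelof X <-> pL_property X.
Proof.
split; first exact: productively_lindelof_pL.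
exact: pL_productively_lindelof.
Qed.
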